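(* Let $\alpha>1$. Let $X,X_1,X_2,\ldots$ be i.i.d. non-negative random variables with mean $\nu>0$ and with moment-generating function $\mathbb{E}[e^{\vartheta X}]$ finite for all $\vartheta$ in an open set containing $0$, and let $a>\nu$. For $N$ such that $Na$ and $N^\alpha$ are integers, let $Z\sim\mathrm{Pois}(Na)$ be independent of $(X_i)_i$, and let $$L(x):=\left(\frac xa\right)^{Na}e^{N(a-x)},\qquad x\geqslant0.$$ Then the importance sampling estimator $\hat p_N^{(n)}(a)$ (defined in the context) is asymptotically efficient for estimating $p_N(a):=\mathbb{P}(\mathrm{Pois}(N\overline{X}_{N^\alpha})=Na)$; that is, $$\limsup_{N\to\infty}\frac1N\log\mathbb{E}\left[L^2\left(\overline{X}_{N^\alpha}\right)\mathbf{1}\{Z=Na\}\right]\leqslant-2\,I(a\,|\,\nu),\qquad\text{where } I(a\,|\,\nu):=a\log\frac a\nu-a+\nu.$$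
   Context: For a positive integer $m$, $\overline{X}_m:=\frac1m\sum_{i=1}^mX_i$. For a non-negative random variable $Y$, $\mathrm{Pois}(Y)$ denotes a mixed Poisson random variable: conditionally on $Y=y$ it is Poisson with mean $y$. The estimator based on $n$ runs is $$\hat p_N^{(n)}(a):=\frac1n\sum_{i=1}^n\frac{\mathbb{P}\left(\mathrm{Pois}(N\overline{X}_{N^\alpha,i})=Z_i\right)}{\mathbb{P}(\mathrm{Pois}(Na)=Z_i)}\,\mathbf{1}\{Z_i=Na\},$$ where $Z_1,\ldots,Z_n$ are independent $\mathrm{Pois}(Na)$ random variables and, independently, $\overline{X}_{N^\alpha,1},\ldots,\overline{X}_{N^\alpha,n}$ are independent copies of $\overline{X}_{N^\alpha}$ under the original distribution of the $X_i$; in the numerator the probability is the Poisson probability given the value of $\overline{X}_{N^\alpha,i}$. On $\{Z_i=Na\}$ the likelihood ratio of the $i$-th run equals $L(\overline{X}_{N^\alpha,i})$. Asymptotic efficiency means precisely the displayed $\limsup$ inequality. The limit in $N$ is along values for which $Na$ and $N^\alpha$ are positive integers. *)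

(* Defs.v *)
From HB Require Import structures.
From mathcomp Require Import all_boot all_order all_algebra.
From mathcomp Require Import all_classical all_reals all_analysis.

Set Implicit Arguments.
Unset Strict Implicit.
Unset Printing Implicit Defensive.

Import Order.TTheory GRing.Theory Num.Theory.
Import numFieldNormedType.Exports.

Local Open Scope classical_set_scope.
Local Open Scope ring_scope.

(* The sigma-algebra on T generated by a random element f. *)
Definition sigma_of (T : Type) (d' : measure_display) (S : measurableType d')
    (f : T -> S) : set (set T) :=
  preimage_set_system setT f measurable.

(* Mutual independence: the product rule over every finite subfamily. *)
Definition independent (R : realType) (d : measure_display)
    (T : measurableType d) (P : probability T R) (I : choiceType)
    (F : I -> set (set T)) : Prop :=
  forall (J : seq I) (A : I -> set T),
    uniq J -> (forall i, i \in J -> F i (A i)) ->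
    P (\bigcap_(i in [set` J]) A i) = (\prod_(i <- J) P (A i))%E.

Definition independent2 (R : realType) (d : measure_display)
    (T : measurableType d) (P : probability T R) (F G : set (set T)) : Prop :=
  forall A B, F A -> G B -> P (A `&` B) = (P A * P B)%E.

(* The two random elements may live on different probability spaces. *)
Definition same_law (R : realType) (d1 d2 d' : measure_display)
    (T1 : measurableType d1) (T2 : measurableType d2) (S : measurableType d')
    (P1 : probability T1 R) (P2 : probability T2 R)
    (f : T1 -> S) (g : T2 -> S) : Prop :=
  forall A : set S, measurable A -> P1 (f @^-1` A) = P2 (g @^-1` A).

Definition iid (R : realType) (d : measure_display) (T : measurableType d)
    (P : probability T R) (X : nat -> {RV P >-> R}) : Prop :=
  independent P (fun i => sigma_of (X i)) /\
  forall i j, same_law P P (X i) (X j).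

(* The Poisson law with mean y >= 0; y = 0 gives the Dirac mass at 0.  The
   library's [poisson_prob] ignores its second argument. *)
Definition Pois (R : realType) (y : R) : set nat -> \bar R :=
  poisson_prob y 0%N.

(* P(Pois(y) = k).  The library's [poisson_pmf y k] is not used, since its
   value at y = 0 is 1 for every k. *)
Definition pois_pr (R : realType) (y : R) (k : nat) : R :=
  fine (Pois y [set k]).

Definition has_pois_law (R : realType) (d : measure_display)
    (T : measurableType d) (P : probability T R) (Z : T -> nat) (y : R) : Prop :=
  forall A : set nat, P (Z @^-1` A) = Pois y A.

(* X 0 plays the role of the generic copy X, so that the sample is
   X 1, ..., X m. *)
Definition sample_mean (R : realType) (T : Type) (X : nat -> T -> R) (m : nat)
    (w : T) : R :=
  m%:R^-1 * \sum_(1 <= i < m.+1) X i w.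

Section ImportanceSampling.
Variables (R : realType) (alpha a : R).

(* The scaling parameters N; N itself need not be an integer.  For a > 0 both
   N a and N^alpha are then positive integers. *)
Definition admissible : set R :=
  [set N | [/\ 0 < N, N * a \is a Num.nat & N `^ alpha \is a Num.nat]].

Definition sample_size (N : R) : nat := Num.truncn (N `^ alpha).

Definition L (N x : R) : R := (x / a) `^ (N * a) * expR (N * (a - x)).

Definition hit (N : R) (z : nat) : R := (z%:R == N * a)%:R.

Definition is_estimator (N : R) (n : nat) (T : Type)
    (Zr : 'I_n -> T -> nat) (Xr : 'I_n -> T -> R) (w : T) : R :=
  n%:R^-1 * \sum_(i < n)
    pois_pr (N * Xr i w) (Zr i w) / pois_pr (N * a) (Zr i w) * hit N (Zr i w).

(* The joint law of the n runs under the importance sampling measure Q: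
   Zr i ~ Pois(N a), Xr i is a copy of the mean of N^alpha of the X's (under
   their original law P), and all 2n variables are independent. *)
Definition is_runs (d dQ : measure_display)
    (T : measurableType d) (P : probability T R) (X : nat -> {RV P >-> R})
    (U : measurableType dQ) (Q : probability U R) (N : R) (n : nat)
    (Zr : 'I_n -> {RV Q >-> nat}) (Xr : 'I_n -> {RV Q >-> R}) : Prop :=
  [/\ forall i, has_pois_law Q (Zr i) (N * a),
      forall i, same_law Q P (Xr i) (sample_mean X (sample_size N)),
      forall i w, 0 <= Xr i w &
      independent Q (fun s : 'I_n + 'I_n => match s with
        | inl i => sigma_of (Zr i)
        | inr i => sigma_of (Xr i)
        end)].

Definition rate (nu : R) : R := a * ln (a / nu) - a + nu.

End ImportanceSampling.

(* Main.v *)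
Require Import Defs.
From HB Require Import structures.
From mathcomp Require Import all_boot all_order all_algebra.
From mathcomp Require Import all_classical all_reals all_analysis.
From mathcomp Require Import finmap measurable_realfun.
From mathcomp Require Import ring lra.

(* The exponent of [L] is concave in x, so it lies below its tangent at nu:
   L(x)^2 <= exp (2 N b (x - nu) - 2 N I) with b = a / nu - 1.  At the mean of
   m = N^alpha variables the expectation of the right-hand side is
   exp (- 2 N (b nu + I)) M(t)^m, where M is the moment-generating function of
   X and t = 2 N b / m -> 0.  Since M(t) <= exp (t nu + O(t^2)), the terms
   linear in t cancel and an error O(N^2 / m) is left, which is o(N) because
   alpha > 1.  The indicator of {Z = N a} is simply bounded by 1. *)

Set Implicit Arguments.
Unset Strict Implicit.
Unset Printing Implicit Defensive.

Import Order.TTheory GRing.Theory Num.Theory.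
Import numFieldNormedType.Exports.

Local Open Scope classical_set_scope.
Local Open Scope ring_scope.

(** * Poisson probabilities and the likelihood ratio *)

Lemma pois_prE (R : realType) (y : R) (k : nat) : 0 <= y -> (0 < k)%N ->
  pois_pr y k = y ^+ k / k`!%:R * expR (- y).
Proof.
rewrite le_eqVlt => /predU1P[<-|y0] k0.
  rewrite /pois_pr /Pois /poisson_prob ltxx diracE memNset/=.
    by rewrite expr0n gtn_eqF// !mul0r.
  by move=> /= k0'; rewrite -k0' in k0.
rewrite /pois_pr /Pois /poisson_prob y0 esum_set1/= ?lee_fin ?poisson_pmf_ge0//.
by rewrite /poisson_pmf y0.
Qed.

(** The factorials and the powers of [N] cancel, and [k%:R = N * a] turns the real power in [L] into
    a natural one. This identifies the likelihood ratio of a run that hits the target. *)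
Lemma pois_pr_ratio (R : realType) (a N x : R) (k : nat) :
  0 < a -> 0 < N -> 0 <= x -> k%:R = N * a ->
  pois_pr (N * x) k / pois_pr (N * a) k = L a N x.
Proof.
move=> a0 N0 x0 kE.
have k0 : (0 < k)%N by rewrite -(ltr_nat R) kE mulr_gt0.
have f0 : k`!%:R != 0 :> R by rewrite pnatr_eq0 -lt0n fact_gt0.
rewrite !pois_prE ?mulr_ge0 ?(ltW N0) ?(ltW a0)//.
rewrite /L -kE powR_mulrn ?divr_ge0 ?(ltW a0)// kE expr_div_n.
have -> : N * (a - x) = - (N * x) + N * a by ring.
rewrite expRD !expRN !exprMn.
have ea := expR_gt0 (N * a).
have ex := expR_gt0 (N * x).
by field; rewrite ?expf_neq0 ?lt0r_neq0 ?f0.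
Qed.

(** * Pointwise exponential bounds *)

Lemma L_sqr_le (R : realType) (a nu N x : R) :
  0 < a -> 0 < nu -> 0 < N -> 0 <= x ->
  L a N x ^+ 2 <= expR (2 * N * ((a / nu - 1) * (x - nu) - rate a nu)).
Proof.
move=> a0 nu0 N0; rewrite le_eqVlt => /predU1P[<-|x0].
  (* At [x = 0] the left side vanishes, because the exponent [N * a] is nonzero. *)
  by rewrite /L mul0r powR0 ?mul0r ?expr0n ?expR_ge0// gt_eqF// mulr_gt0.
rewrite -mulrA expRM_natl ler_pXn2r ?nnegrE ?expR_ge0//; last first.
  by rewrite mulr_ge0 ?powR_ge0 ?expR_ge0.
rewrite /L /powR gt_eqF ?divr_gt0// -expRD ler_expR -mulrA -mulrDr ler_pM2l//.
(* Centring at [nu] makes ln (1 + u) <= u, with u = x / nu - 1, the tangent inequality at x = nu;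
   the divisor supplies the term [ln (a / nu)] of [rate]. *)
have -> : x / a = (1 + (x / nu - 1)) / (a / nu).
  by field; rewrite ?lt0r_neq0.
rewrite ln_div ?posrE ?divr_gt0//; last by rewrite addrC subrK divr_gt0.
have : ln (1 + (x / nu - 1)) <= x / nu - 1.
  by apply: le_ln1Dx; rewrite ltrBDr addNr divr_gt0.
move=> /(ler_wpM2l (ltW a0)) h; rewrite /rate.
have -> : (a / nu - 1) * (x - nu) = a * (x / nu - 1) - x + nu.
  by field; rewrite lt0r_neq0.
lra.
Qed.

(** The remainder e^(t x) - 1 - t x is at most (t x)^2 e^(t x). With (s x)^2 <= e^(2 s x) and e^(t
    x) <= e^(s x), this leaves (t / s)^2 times a function free of t, whose expectation is a
    moment-generating function at 3 s. *)
Lemma expR_le_quadratic (R : realType) (s t x : R) :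
  0 < s -> 0 <= t <= s -> 0 <= x ->
  expR (t * x) <= 1 + t * x + (t / s) ^+ 2 * expR (3 * s * x).
Proof.
move=> s0 /andP[t0 ts] x0.
have tx0 : 0 <= t * x by rewrite mulr_ge0.
(* (1 + y) e^(-y) + y^2 >= (1 + y) (1 - y) + y^2 = 1 *)
have h y : 0 <= y -> expR y <= 1 + y + y ^+ 2 * expR y :> R.
  move=> y0; have := expR_ge1Dx (- y); rewrite expRN.
  have ey : 0 < expR y := expR_gt0 y.
  rewrite -(ler_pM2r ey) mulVf ?gt_eqF// => h1.
  have : 0 <= (1 + y) * (1 - (1 + - y) * expR y).
    by rewrite mulr_ge0 ?subr_ge0// addr_ge0.
  lra.
apply: le_trans (h _ tx0) _; rewrite lerD2l.
have sx : s * x <= expR (s * x).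
  by apply: le_trans (expR_ge1Dx _); rewrite lerDr.
have -> : (t * x) ^+ 2 = (t / s) ^+ 2 * (s * x) ^+ 2.
  by field; rewrite gt_eqF.
rewrite -(mulrA (_ ^+ 2)); apply: ler_wpM2l; first exact: sqr_ge0.
have -> : 3 * s * x = 2%:R * (s * x) + s * x by ring.
rewrite expRD expRM_natl; apply: ler_pM; rewrite ?sqr_ge0 ?expR_ge0//.
  by rewrite lerXn2r ?nnegrE ?expR_ge0// mulr_ge0// ltW.
by rewrite ler_expR; apply: ler_wpM2r.
Qed.

(** * Expectations of products under independence *)

Section product_of_expectations.
Context (R : realType) (d : measure_display) (T : measurableType d).
Variable P : probability T R.

Import HBNNSimple.

(** Passage from indicators of [B] to a nonnegative measurable [f], by simple functions and monotone
    convergence. The constant [c] stands for a bound on the expectation of [G]. *)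
Lemma integral_compM_le (Y G : T -> R) (c : \bar R) (f : R -> R) :
  measurable_fun setT Y -> measurable_fun setT G -> (forall w, 0 <= G w) ->
  (0 <= c)%E ->
  (forall B : set R, measurable B ->
    (\int[P]_w (\1_(Y @^-1` B) w * G w)%:E <= P (Y @^-1` B) * c)%E) ->
  measurable_fun setT f -> (forall x, 0 <= f x) ->
  (\int[P]_w (f (Y w) * G w)%:E <= (\int[P]_w (f (Y w))%:E) * c)%E.
Proof.
move=> mY mG G0 c0 indic_le mf f0.
have mf' : measurable_fun setT (EFin \o f) by exact/measurable_EFinP.
pose h := @nnsfun_approx _ (measurableTypeR R) R setT measurableT _ mf'.
have h0 n x : 0 <= h n x by [].
have hcvg x : h n x @[n --> \oo] --> f x.
  suff /fine_cvgP[_ //] : (EFin \o h ^~ x) n @[n --> \oo] --> (f x)%:E.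
  apply: (@cvg_nnsfun_approx _ (measurableTypeR R) R setT measurableT _ mf') => //.
  by move=> y _; rewrite lee_fin.
have hnd x : nondecreasing_seq (h ^~ x).
  by move=> m n mn; exact/lefP/nd_nnsfun_approx.
have hle n x : h n x <= f x.
  rewrite -(cvg_lim _ (hcvg x))//; apply: nondecreasing_cvgn_le => //.
  by apply/cvg_ex; exists (f x).
have mhY n : measurable_fun setT (h n \o Y) by exact: measurableT_comp.
have mhYG n : measurable_fun setT (fun w => (h n (Y w) * G w)%:E).
  by apply/measurable_EFinP; exact: (measurable_funM (mhY n) mG).
have hYG0 n w : (0 <= (h n (Y w) * G w)%:E)%E by rewrite lee_fin mulr_ge0.
have hYGnd w : nondecreasing_seq (fun n => (h n (Y w) * G w)%:E).
  by move=> m n mn; rewrite lee_fin; apply: ler_wpM2r => //; exact: hnd.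
rewrite (eq_integral (fun w => limn (fun n => (h n (Y w) * G w)%:E))); last first.
  move=> w _; apply/esym/cvg_lim => //; apply: cvg_EFin; first exact: nearW.
  by apply: cvgMr_tmp; exact: hcvg.
rewrite monotone_convergence//.
apply: lime_le; first apply: ereal_nondecreasing_is_cvgn => m n mn.
  by apply: ge0_le_integral => // w _; exact: hYGnd.
near=> n.
(* Replacing [f] by the smaller [h n] on the right as well reduces the claim to simple functions. *)
apply: (@le_trans _ _ ((\int[P]_w (h n (Y w))%:E) * c)%E); last first.
  apply: lee_wpmul2r => //; apply: ge0_le_integral => //.
  - by move=> w _; rewrite lee_fin.
  - by apply/measurable_EFinP; exact: (mhY n).
  - by apply/measurable_EFinP; exact: (measurableT_comp mf mY).
  - by move=> w _; rewrite lee_fin.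
pose s : seq R := enum_fset (fset_set (range (h n))).
have mB y : measurable (h n @^-1` [set y]) by exact: measurable_funPTI.
have mYB y : measurable (Y @^-1` (h n @^-1` [set y])).
  by rewrite -[X in measurable X]setTI; exact: (mY measurableT _ (mB y)).
have y0 i : (i < size s)%N -> 0 <= s`_i.
  by move=> /(mem_nth 0); rewrite in_fset_set// => /set_mem[w _ <-].
(* A finite combination of indicators of events of [Y], with nonnegative coefficients: by linearity
   [indic_le] applies term by term. *)
have hE w : h n (Y w) =
    \sum_(i < size s) s`_i * \1_(Y @^-1` (h n @^-1` [set s`_i])) w.
  by rewrite fimfunE fsbig_finite//= (big_nth 0) big_mkord.
under eq_integral do rewrite hE mulr_suml -sumEFin.
under [X in (_ <= X * _)%E]eq_integral do rewrite hE -sumEFin.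
rewrite ge0_integral_sum//; last 2 first.
- move=> i; apply/measurable_EFinP; apply: measurable_funM => //.
  by apply: measurable_funM => //; exact: measurable_indic.
- by move=> i w _; rewrite lee_fin !mulr_ge0// y0.
rewrite ge0_integral_sum//; last 2 first.
- move=> i; apply/measurable_EFinP; apply: measurable_funM => //.
- by move=> i w _; rewrite lee_fin !mulr_ge0// y0.
rewrite ge0_sume_distrl//; last first.
  by move=> i _; apply: integral_ge0 => w _; rewrite lee_fin mulr_ge0// y0.
apply: lee_sum => i _.
under eq_integral do rewrite -mulrA EFinM.
rewrite ge0_integralZl_EFin ?y0//; last 2 first.
- by move=> w _; rewrite lee_fin mulr_ge0.
- apply/measurable_EFinP; apply: measurable_funM => //.
under [X in (_ <= X * _)%E]eq_integral do rewrite EFinM.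
rewrite ge0_integralZl_EFin ?y0//; last first.
  by apply/measurable_EFinP; exact: measurable_indic.
rewrite -muleA; apply: lee_wpmul2l; first by rewrite lee_fin y0.
by rewrite integral_indic// setIT; apply: indic_le; exact: mB.
Unshelve. all: by end_near. Qed.

(* Generalized for the induction on J: the indicator collects the variables
   whose factor has already been replaced by indicators. *)
Lemma integral_prod_indic_le (I : choiceType) (X : I -> {RV P >-> R})
    (f : I -> R -> R) (J K : seq I) (A : I -> set T) :
  independent P (fun i => sigma_of (X i)) ->
  (forall i, measurable_fun setT (f i)) -> (forall i x, 0 <= f i x) ->
  uniq (J ++ K) -> (forall i, i \in K -> sigma_of (X i) (A i)) ->
  (\int[P]_w (\1_(\bigcap_(i in [set` K]) A i) w *
             \prod_(i <- J) f i (X i w))%:E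
   <= (\prod_(i <- J) 'E_P[f i \o X i]) * \prod_(i <- K) P (A i))%E.
Proof.
move=> indX mf f0.
have mbigcap (L : seq I) (C : I -> set T) :
    (forall i, i \in L -> sigma_of (X i) (C i)) ->
    measurable (\bigcap_(i in [set` L]) C i).
  move=> LC; apply: fin_bigcap_measurable => [|i /LC[B mB <-]].
    exact: finite_seq.
  by rewrite setTI; exact: measurable_funPTI.
elim: J K A => [|j J IH] K A.
  (* For empty [J] only the indicator is left, and the claim is the product rule of independence. *)
  move=> uK KA; rewrite big_nil mul1e -indX//.
  under eq_integral do rewrite big_nil mulr1.
  by rewrite integral_indic ?setIT//; exact: mbigcap.
rewrite cat_cons /= => /andP[jJK uJK] KA.
have mA := mbigcap K A KA.
under eq_integral do rewrite big_cons mulrCA.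
have -> : (\prod_(i <- j :: J) 'E_P[f i \o X i] =
    (\int[P]_w (f j (X j w))%:E) * \prod_(i <- J) 'E_P[f i \o X i])%E.
  by rewrite big_cons unlock.
rewrite -muleA.
(* The factor of [j] may be replaced by an indicator of [B]; that case is the induction hypothesis
   with [j] moved from [J] to [K]. *)
apply: (@integral_compM_le (X j)
  (fun w => \1_(\bigcap_(i in [set` K]) A i) w *
    \prod_(i <- J) f i (X i w))) => //.
- apply: measurable_funM; first exact: measurable_indic.
  by apply: measurable_prod => i _; exact: measurableT_comp.
- by move=> w; rewrite mulr_ge0// prodr_ge0.
- rewrite mule_ge0//; first apply: prode_ge0 => i _.
    by apply: expectation_ge0 => w; exact: f0.
  exact: prode_ge0.
move=> B mB.
(* The family [A] with the event of [j] set to {X j in B}; as [j] is not in [K], the events indexed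
   by [K] do not change. *)
pose A' i := if i == j then X j @^-1` B else A i.
have jK : j \notin K by move: jJK; rewrite mem_cat => /norP[].
have A'K i : i \in K -> A' i = A i.
  by move=> iK; rewrite /A' ifN//; apply: contraNneq jK => <-.
have -> : (P (X j @^-1` B) *
      (\prod_(i <- J) 'E_P[f i \o X i] * \prod_(i <- K) P (A i)) =
    \prod_(i <- J) 'E_P[f i \o X i] * \prod_(i <- j :: K) P (A' i))%E.
  rewrite big_cons muleCA {1}/A' eqxx; congr (_ * (_ * _))%E.
  by rewrite big_seq [in RHS]big_seq; apply: eq_bigr => i iK; rewrite A'K.
rewrite (eq_integral (fun w => (\1_(\bigcap_(i in [set` j :: K]) A' i) w *
  \prod_(i <- J) f i (X i w))%:E)).
- apply: IH.
  + by rewrite (perm_uniq (permEl (perm_catCA J [:: j] K))) /= jJK.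
  + move=> i; rewrite inE => /predU1P[->|iK]; last by rewrite A'K//; exact: KA.
    by rewrite /A' eqxx; exists B => //; rewrite setTI.
- move=> w _; congr (_%:E).
  rewrite mulrA; congr (_ * _).
  rewrite -[LHS]/((\1_(X j @^-1` B) \*
    \1_(\bigcap_(i in [set` K]) A i)) w) -indicI.
  congr (\1__ w); apply/seteqP; split => [v [/= jB KAv] i /=|v /= KAv].
    rewrite inE => /predU1P[->|iK]; first by rewrite /A' eqxx.
    by rewrite A'K//; exact: KAv.
  split; first by have := KAv j; rewrite /= inE /A' eqxx; exact.
  by move=> i /= iK; rewrite -A'K//; apply: KAv; rewrite /= inE iK orbT.
Qed.

Lemma expectation_prod_le (I : choiceType) (X : I -> {RV P >-> R})
    (f : I -> R -> R) (J : seq I) :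
  independent P (fun i => sigma_of (X i)) ->
  (forall i, measurable_fun setT (f i)) -> (forall i x, 0 <= f i x) ->
  uniq J ->
  ('E_P[(fun w => \prod_(i <- J) f i (X i w))%R]
   <= \prod_(i <- J) 'E_P[f i \o X i])%E.
Proof.
move=> indX mf f0 uJ.
have := @integral_prod_indic_le _ X f J [::] (fun=> setT) indX mf f0.
rewrite cats0 big_nil mule1 => /(_ uJ (fun _ => ltac:(by []))).
rewrite [X in (X <= _)%E -> _](_ : _ =
    ('E_P[(fun w => \prod_(i <- J) f i (X i w))%R])%E).
  by [].
rewrite [in RHS]expectation.unlock; apply: eq_integral => w _.
by rewrite set_nil bigcap_set0 indicT mul1r.
Qed.

End product_of_expectations.

(** * Moment-generating functions and sums of i.i.d. variables *)

Lemma same_law_expectation (R : realType) (d : measure_display)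
    (T : measurableType d) (P : probability T R) (X Y : {RV P >-> R})
    (f : R -> R) :
  same_law P P X Y -> measurable_fun setT f -> (forall x, 0 <= f x) ->
  'E_P[f \o X]%E = 'E_P[f \o Y]%E.
Proof.
move=> XY mf f0.
have mf' : measurable_fun setT (EFin \o f) by exact/measurable_EFinP.
have f0' : {in [set: R], forall y, (0 <= (EFin \o f) y)%E}.
  by move=> y _; rewrite lee_fin.
have push (V : {RV P >-> R}) :
    'E_P[f \o V]%E = (\int[pushforward P V]_x (EFin \o f) x)%E.
  have mV : measurable_fun setT V by [].
  rewrite (ge0_integral_pushforward mV)//.
  by rewrite [in LHS]expectation.unlock preimage_setT.
rewrite !push; apply: eq_measure_integral => A mA _.
exact: XY.
Qed.

Lemma iid_mmt_gen_sum_le (R : realType) (d : measure_display)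
    (T : measurableType d) (P : probability T R) (X : nat -> {RV P >-> R})
    (t B : R) (m : nat) :
  iid X -> 0 <= B -> ('M_P (X 0%N) t <= B%:E)%E ->
  ('E_P[fun w => expR (t * \sum_(1 <= i < m.+1) X i w)] <= (B ^+ m)%:E)%E.
Proof.
move=> [indX lawX] B0 MB.
have mexp : measurable_fun [set: R] (fun x : R => expR (t * x)).
  by apply: measurableT_comp => //; exact: measurable_funM.
have -> : (fun w => expR (t * \sum_(1 <= i < m.+1) X i w)) =
    (fun w => \prod_(i <- index_iota 1 m.+1) expR (t * X i w)).
  apply/funext => w; rewrite mulr_sumr.
  by rewrite (big_morph _ (@expRD R) (@expR0 R)).
apply: le_trans (expectation_prod_le indX (fun=> mexp) _ (iota_uniq _ _)) _.
  by move=> _ x; exact: expR_ge0.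
have -> : (B ^+ m)%:E = (\prod_(i <- index_iota 1 m.+1) B%:E)%E.
  by rewrite prodEFin prodr_const_nat subn1.
(* Multiplying inequalities between extended reals requires nonnegative factors, so nonnegativity is
   carried through the induction. *)
suff /andP[] : (0%:E <= \prod_(i <- index_iota 1 m.+1)
    'E_P[(fun x => expR (t * x)) \o X i] <=
    \prod_(i <- index_iota 1 m.+1) B%:E)%E by [].
apply: (big_ind2 (fun x y => 0%:E <= x <= y)%E) => [|x1 x2 y1 y2|i _].
- by rewrite lee_fin ler01 lexx.
- by move=> /andP[x0 x12] /andP[y0 y12]; rewrite mule_ge0//= lee_pmul.
apply/andP; split.
  by apply: expectation_ge0 => w /=; exact: expR_ge0.
rewrite (same_law_expectation (lawX i 0%N))//.
rewrite [X in ('E_P[X] <= _)%E](_ : _ = expR \o t \o* X 0%N)//.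
by apply/funext => w /=; rewrite mulrC.
Qed.

(** Integrating [expR_le_quadratic] gives 1 + t nu + (t / s)^2 C; then 1 + u <= e^u puts the bound
    in exponential form, whose m-th power is explicit. *)
Lemma mmt_gen_le (R : realType) (d : measure_display)
    (T : measurableType d) (P : probability T R) (X : {RV P >-> R})
    (nu s t C : R) :
  (forall w, 0 <= X w) -> ('E_P[X] = nu%:E)%E ->
  ('M_P X (3 * s) = C%:E)%E -> 0 < s -> 0 <= t <= s ->
  ('M_P X t <= (expR (t * nu + (t / s) ^+ 2 * C))%:E)%E.
Proof.
move=> X0 EX MC s0 ts.
have [t0 _] := andP ts.
have k0 : 0 <= (t / s) ^+ 2 by exact: sqr_ge0.
have hq w := expR_le_quadratic s0 ts (X0 w).
move: ((t / s) ^+ 2) k0 hq => k k0 hq.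
apply: (@le_trans _ _ (1 + (t * nu + k * C))%:E); last first.
  by rewrite lee_fin expR_ge1Dx.
have mX : measurable_fun setT X by [].
have mexp : measurable_fun setT (fun w => expR (3 * s * X w)).
  by apply: measurableT_comp => //; exact: measurable_funM.
have EX' : (\int[P]_w (X w)%:E = nu%:E)%E by rewrite -EX expectation_def.
have MC' : (\int[P]_w (expR (3 * s * X w))%:E = C%:E)%E.
  rewrite -MC /mmt_gen_fun expectation.unlock; apply: eq_integral => w _ /=.
  by rewrite mulrC.
(* The bound is written as an integral, so that [hq] compares the integrands. *)
have -> : (1 + (t * nu + k * C))%:E =
  (\int[P]_w (1%:E + (t%:E * (X w)%:E + k%:E * (expR (3 * s * X w))%:E)))%E.
  rewrite ge0_integralD//; last 2 first.
  - move=> w _; rewrite -!EFinM -EFinD lee_fin.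
    by rewrite addr_ge0 ?mulr_ge0 ?expR_ge0.
  - rewrite [X in measurable_fun _ X](_ : _ =
      EFin \o (fun w => t * X w + k * expR (3 * s * X w)))//.
    by apply/measurable_EFinP; apply: measurable_funD; exact: measurable_funM.
  rewrite integral_cst// [X in (1 * X + _)%E](probability_setT P) mule1.
  rewrite ge0_integralD//; last 4 first.
  - by move=> w _; rewrite -EFinM lee_fin mulr_ge0.
  - by apply/measurable_EFinP; exact: measurable_funM.
  - by move=> w _; rewrite -EFinM lee_fin mulr_ge0 ?expR_ge0.
  - by apply/measurable_EFinP; exact: measurable_funM.
  rewrite !ge0_integralZl_EFin//; do 4?[exact/measurable_EFinP
    | by move=> w _; rewrite lee_fin ?expR_ge0].
  by rewrite EX' MC' -!EFinM -!EFinD.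
rewrite /mmt_gen_fun expectation.unlock; apply: ge0_le_integral => //=.
- apply/measurable_EFinP/measurableT_comp => //; exact: measurable_funM.
- rewrite [X in measurable_fun _ X](_ : _ =
      EFin \o (fun w => 1 + (t * X w + k * expR (3 * s * X w))))//.
  apply/measurable_EFinP; apply: measurable_funD => //.
  by apply: measurable_funD; exact: measurable_funM.
- by move=> w _; rewrite -!EFinM -!EFinD lee_fin addrA mulrC.
Qed.

(** * Limit superior and growth of the sample size *)

Lemma limf_esup_le (R : realType) (T : choiceType) (U : filteredType T)
    (F : set_system U) (f : U -> \bar R) (c : R) :
  (forall e : R, 0 < e -> \forall x \near F, (f x <= (c + e)%:E)%E) ->
  (limf_esup f F <= c%:E)%E.
Proof.
move=> fc; apply/lee_addgt0Pr => e e0.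
(* The limit superior is an infimum, over the sets of the filter, of suprema; the set where [f] is
   at most c + e is one of these sets. *)
apply: ge_ereal_inf; exists (ereal_sup (f @` [set x | (f x <= (c + e)%:E)%E])).
  by exists [set x | (f x <= (c + e)%:E)%E] => //; exact: fc.
by apply: ge_ereal_sup => _ [x /= fx <-].
Qed.

Lemma near_pinfty_div_powR_le (R : realType) (alpha e : R) : 1 < alpha -> 0 < e ->
  \forall N \near +oo, N / N `^ alpha <= e.
Proof.
move=> a1 e0.
have a0 : 0 < alpha - 1 by rewrite subr_gt0.
near=> N.
have N0 : 0 < N by near: N; exact: nbhs_pinfty_gt.
rewrite -[X in X / _](powRr1 (ltW N0)) -powRB ?(lt_eqF a1)//.
have -> : 1 - alpha = - (alpha - 1) by rewrite opprB.
rewrite powRN invf_ple ?posrE ?powR_gt0//.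
(* The threshold for [N] is (1 / e)^(1 / (alpha - 1)); what remains is monotonicity of the power. *)
have -> : e^-1 = (e^-1 `^ (alpha - 1)^-1) `^ (alpha - 1).
  by rewrite -powRrM mulVf ?gt_eqF// powRr1// invr_ge0 ltW.
apply: ge0_ler_powR; rewrite ?nnegrE ?powR_ge0 ?(ltW a0) ?(ltW N0)//.
Unshelve. all: by end_near. Qed.

(** * The second moment and its exponential decay *)

(** A bound for fixed [N] and any sample size [m], with the whole error carried by N / m. The last
    hypothesis is t <= s for t = 2 b N / m, the range in which [mmt_gen_le] applies. *)
Lemma expectation_L_sqr_hit_le (R : realType) (d : measure_display)
    (T : measurableType d) (P : probability T R)
    (X : nat -> {RV P >-> R}) (Z : {RV P >-> nat}) (nu a N s C : R) (m : nat) :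
  iid X -> (forall i w, 0 <= X i w) -> 0 < nu -> ('E_P[X 0%N] = nu%:E)%E ->
  ('M_P (X 0%N) (3 * s) = C%:E)%E -> nu < a -> 0 < N -> (0 < m)%N -> 0 < s ->
  2 * (a / nu - 1) * (N / m%:R) <= s ->
  ('E_P[fun w => (L a N (sample_mean X m w) ^+ 2 * hit a N (Z w))%R] <=
   (expR (N * (- (2 * rate a nu) +
     (2 * (a / nu - 1) / s) ^+ 2 * C * (N / m%:R))))%:E)%E.
Proof.
move=> iidX X0 nu0 EX MC nua N0 m0 s0 ts.
have a0 : 0 < a := lt_trans nu0 nua.
have m0' : 0 < m%:R :> R by rewrite ltr0n.
set b := a / nu - 1 in ts *.
(* Since [nu < a], the slope [b] is positive, so [t] lies on the nonnegative side required by
   [mmt_gen_le]. *)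
have b0 : 0 < b by rewrite subr_gt0 ltr_pdivlMr// mul1r.
pose t := 2 * b * (N / m%:R).
have t0 : 0 <= t by rewrite !mulr_ge0 ?invr_ge0 ?ltW.
pose S w := \sum_(1 <= i < m.+1) X i w.
have S0 w : 0 <= S w by apply: sumr_ge0.
have mS : measurable_fun setT S by exact: measurable_sum.
have mmean : measurable_fun setT (sample_mean X m) by exact: measurable_funM.
(* [K] collects the part of the tangent bound that is free of the sample; the rest, 2 N b times the
   mean, equals t S. *)
pose K := expR (- (2 * N * (b * nu + rate a nu))).
have LS w :
    L a N (sample_mean X m w) ^+ 2 * hit a N (Z w) <= K * expR (t * S w).
  apply: (@le_trans _ _ (L a N (sample_mean X m w) ^+ 2)).
    by rewrite ler_piMr ?sqr_ge0// /hit; case: eqP.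
  have mean0 : 0 <= sample_mean X m w.
    by rewrite mulr_ge0 ?invr_ge0 ?ler0n ?S0.
  apply: le_trans (L_sqr_le a0 nu0 N0 mean0) _.
  rewrite /K -expRD ler_expR /sample_mean -/(S w) -/b /t le_eqVlt.
  by apply/orP; left; apply/eqP; field; rewrite gt_eqF.
have mexp : measurable_fun setT (fun w => expR (t * S w)).
  by apply: measurableT_comp => //; exact: measurable_funM.
apply: (@le_trans _ _ (K%:E * 'E_P[(fun w => expR (t * S w))%R])%E).
  rewrite expectation.unlock -ge0_integralZl_EFin ?expR_ge0//; last first.
    exact/measurable_EFinP.
  apply: ge0_le_integral => //.
  - by move=> w _; rewrite lee_fin mulr_ge0 ?sqr_ge0 /hit ?ler0n.
  - apply/measurable_EFinP; apply: measurable_funM.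
      apply: measurable_funX; apply: measurable_funM.
        apply: (measurableT_comp (measurable_powR _)).
        exact: measurable_funM.
      apply: measurableT_comp => //; apply: measurable_funM => //.
      exact: measurable_funB.
    exact: (@measurableT_comp _ _ _ _ _ _ (hit a N)).
  - under eq_fun do rewrite -EFinM.
    by apply/measurable_EFinP; exact: measurable_funM.
  - by move=> w _; rewrite -EFinM lee_fin; exact: LS.
apply: (@le_trans _ _ (K%:E * (expR (t * nu + (t / s) ^+ 2 * C) ^+ m)%:E)%E).
  rewrite lee_wpmul2l ?lee_fin ?expR_ge0//.
  apply: iid_mmt_gen_sum_le; rewrite ?expR_ge0//.
  by apply: mmt_gen_le => //; rewrite t0.
(* Here m t nu = 2 N b nu cancels against [K], and m (t / s)^2 C = N (2 b / s)^2 C (N / m)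
   remains. *)
rewrite -EFinM lee_fin -expRM_natl /K -expRD ler_expR /t le_eqVlt.
by apply/orP; left; apply/eqP; field; rewrite !gt_eqF.
Qed.

Theorem proposition4p1 (R : realType) (d : measure_display)
    (T : measurableType d) (P : probability T R)
    (X : nat -> {RV P >-> R}) (Z : R -> {RV P >-> nat}) (alpha nu a : R)
    (halpha : 1 < alpha)
    (hiid : iid X)
    (hX0 : forall i w, 0 <= X i w)
    (hnu : 0 < nu)
    (hmean : ('E_P[X 0%N] = nu%:E)%E)
    (hmgf : exists U : set R, [/\ open U, U 0 &
        forall theta, U theta -> ('M_P (X 0%N) theta < +oo)%E])
    (ha : nu < a)
    (hZ : forall N, admissible alpha a N -> has_pois_law P (Z N) (N * a))
    (hZX : forall N, admissible alpha a N ->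
        independent2 P (sigma_of (Z N))
          <<s \bigcup_(i in [set i | (0 < i)%N]) sigma_of (X i) >>) :
  (forall (N : R) (n : nat) (dQ : measure_display) (U : measurableType dQ)
      (Q : probability U R)
      (Zr : 'I_n -> {RV Q >-> nat}) (Xr : 'I_n -> {RV Q >-> R}),
    admissible alpha a N -> (0 < n)%N -> is_runs alpha a X N Zr Xr ->
    forall w, is_estimator a N Zr Xr w =
      n%:R^-1 * \sum_(i < n) L a N (Xr i w) * hit a N (Zr i w)) /\
  (limf_esup
     (fun N : R => (N^-1)%:E *
        lne ('E_P[fun w =>
          (L a N (sample_mean X (sample_size alpha N) w) ^+ 2
           * hit a N (Z N w))%R]))
     (within (admissible alpha a) (pinfty_nbhs R))
   <= (- (2 * rate a nu))%:E)%E.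
Proof.
have a0 : 0 < a := lt_trans hnu ha.
split=> [N n dQ U Q Zr Xr [N0 _ _] _ [_ _ Xr0 _] w|].
  rewrite /is_estimator; congr (_ * _); apply: eq_bigr => i _.
  (* Off the event Z = N a both summands vanish; on it the ratio is [L]. *)
  rewrite /hit; have [ZN|_] := eqVneq; last by rewrite !mulr0.
  by rewrite pois_pr_ratio.
have [U [oU U0 MU]] := hmgf.
have [r /= r0 rU] : exists2 r : R, 0 < r & ball 0 r `<=` U.
  by apply/nbhs_ballP; exact: open_nbhs_nbhs.
(* With this choice 3 s = r / 2 lies inside the ball where the moment-generating function is
   finite. *)
pose s := r / 6.
have s0 : 0 < s by rewrite divr_gt0.
have Ms : ('M_P (X 0%N) (3 * s) < +oo)%E.
  apply/MU/rU; rewrite /ball/= sub0r normrN gtr0_norm ?mulr_gt0// /s.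
  by lra.
have Ms0 : (0 <= 'M_P (X 0%N) (3 * s))%E.
  by apply: expectation_ge0 => w; exact: expR_ge0.
have MC : ('M_P (X 0%N) (3 * s) = (fine ('M_P (X 0%N) (3 * s)))%:E)%E.
  by rewrite fineK// ge0_fin_numE.
set C := fine _ in MC.
have C0 : 0 <= C by exact: fine_ge0.
pose b := a / nu - 1.
have b0 : 0 < b by rewrite subr_gt0 ltr_pdivlMr// mul1r.
apply: limf_esup_le => e e0.
pose D := (2 * b / s) ^+ 2 * C.
have D0 : 0 <= D by rewrite mulr_ge0 ?sqr_ge0.
(* Thresholds for N / N^alpha: the first ensures t <= s, the second makes the error D N / m at most
   [e]. The denominator is [D + 1] because [D] may be 0. *)
have eta1 : 0 < s / (2 * b) by rewrite divr_gt0 ?mulr_gt0.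
have eta2 : 0 < e / (D + 1) by rewrite divr_gt0 ?ltr_wpDl.
rewrite near_withinE; near=> N => -[N0 _ Nalpha].
have q1 : N / N `^ alpha <= s / (2 * b).
  by near: N; exact: near_pinfty_div_powR_le.
have q2 : N / N `^ alpha <= e / (D + 1).
  by near: N; exact: near_pinfty_div_powR_le.
(* Admissibility makes N^alpha a natural number, so the truncation is exact. *)
have mE : (sample_size alpha N)%:R = N `^ alpha by exact: truncnK.
have m0 : (0 < sample_size alpha N)%N by rewrite -(ltr_nat R) mE powR_gt0.
have qs : 2 * b * (N / (sample_size alpha N)%:R) <= s.
  by rewrite mE mulrC -ler_pdivlMr ?mulr_gt0.
have qe : D * (N / (sample_size alpha N)%:R) <= e.
  apply: (@le_trans _ _ ((D + 1) * (N / (sample_size alpha N)%:R))).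
    by rewrite ler_wpM2r ?lerDl// divr_ge0 ?(ltW N0).
  by rewrite mE mulrC -ler_pdivlMr ?ltr_wpDl.
have EL := expectation_L_sqr_hit_le (Z N) hiid hX0 hnu hmean MC ha N0 m0 s0 qs.
rewrite -/b -/D in EL.
set E := ('E_P[_])%E in EL *.
have E0 : (0 <= E)%E.
  by apply: expectation_ge0 => w; rewrite mulr_ge0 ?sqr_ge0 /hit ?ler0n.
set v := N * _ in EL.
apply: (@le_trans _ _ ((N^-1)%:E * v%:E)%E).
  rewrite lee_wpmul2l ?lee_fin ?invr_ge0 ?(ltW N0)//.
  (* This form reduces the claim to monotonicity of [lne] on the nonnegative extended reals, which
     also covers [E] equal to 0. *)
  have -> : v%:E = lne (expR v)%:E by rewrite lne_EFin ?expR_gt0// expRK.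
  by rewrite lee_lne ?in_itv/= ?E0 ?leey ?lee_fin ?expR_ge0.
by rewrite -EFinM lee_fin /v mulKf ?gt_eqF// lerD2l.
Unshelve. all: by end_near. Qed.
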